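(* Consider the system, the weight update law and the projection described in the context, let Assumption 1 of the context hold, and define $V_a(K_t)=\frac1\theta\operatorname{tr}(\tilde K_t^\top\tilde K_t)$ with $\tilde K_t=K_t-W^*$. Then for all $t$ (where $j$ denotes the index with $t_j\le t\le t_{j+1}-1$): (i) $V_a(K_t)\le\frac4\theta\bar W$; (ii) $V_a(K_{t+1})-V_a(K_t)\le-\frac{1-\theta}{\sigma^2}\|\tilde u_t\|^2+\|\varepsilon_j(x_t)\|^2$; (iii) $\tilde u_t$ is $\bar\varepsilon^2$ small in mean square sense with $c_0=\frac{\sigma^2}{1-\theta}$ and $c_0'=\frac{4c_0}{\theta}\bar W$.
   Context: $\|\cdot\|$ is the Euclidean norm; $M^{(i)}$ is the $i$-th column of $M$; $M^\dagger$ is the pseudo-inverse. **System.** $x_{t+1}=f(x_t)+g(x_t)(u_t+h(x_t))$, $t=0,1,2,\dots$, with $u_t=u_t^a+u_t^m\in\mathbb R^m$ and standing constraint $x_t\in\mathcal X$ for all $t$, where $\mathcal X\subset\mathbb R^d$ is compact. $f:\mathbb R^d\to\mathbb R^d$ and $g:\mathbb R^d\to\mathbb R^{d\times m}$ are Lipschitz, $h:\mathbb R^d\to\mathbb R^m$ is continuous, and $g(x)$ has rank $m$ for all $x$, so $g(x)^\dagger=(g(x)^\top g(x))^{-1}g(x)^\top$. Put $\bar f(x,u)=f(x)+g(x)u$. The component $u_t^m$ is produced by another controller. **Learning component.** $W^*\in\mathbb R^{(n_L+1)\times m}$ is a fixed (ideal) weight matrix. There are times $0=t_0<t_1<t_2<\cdots$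 and feature maps $\phi_j:\mathbb R^d\to\mathbb R^{n_L+1}$ ($j\ge0$), whose first $m$ entries equal $1$, and reconstruction errors $\varepsilon_j$ with $h(x)=W^{*\top}\phi_j(x)+\varepsilon_j(x)$ for $x\in\mathcal X$. For $t\in\{t_j,\dots,t_{j+1}-1\}$, $u_t^a=-K_t^\top\phi_j(x_t)$, and with learning rate $\theta\in(0,1)$, $$\bar K_{t+1}=K_t+\frac{\theta}{\|\phi_j(x_t)\|^2}\,\phi_j(x_t)\big(g(x_t)^\dagger(x_{t+1}-\bar f(x_t,u_t^m))\big)^\top.$$ Projection: for $i=1,\dots,m$, $K_{t+1}^{(i)}=\bar K_{t+1}^{(i)}$ if $\|\bar K_{t+1}^{(i)}\|\le\bar W_i$, and $K_{t+1}^{(i)}=\frac{\bar W_i}{\|\bar K_{t+1}^{(i)}\|}\bar K_{t+1}^{(i)}$ otherwise. Initially $\|K_0^{(i)}\|\le\bar W_i$. Let $\bar W=\sum_{i=1}^m\bar W_i^2$ and $\tilde u_t=u_t^a+h(x_t)=-\tilde K_t^\top\phi_j(x_t)+\varepsilon_j(x_t)$. **Assumption 1.** There are $\bar W_i>0$ ($i=1,\dots,m$) and $\sigma,\bar\varepsilon>0$ such that $\|W^{*(i)}\|\le\bar W_i$ for all $i$, and $\|\phi_j(x)\|\le\sigma$, $\|\varepsilon_j(x)\|\le\bar\varepsilon$ for every $x\in\mathcal X$ and $j\ge0$. **Definition.** A vector sequence $(s_t)_{t\ge0}$ is $\mu$ small in mean square sense (with constants $c_0,c_0'\ge0$) if $\sum_{t=k}^{k+N-1}\|s_t\|^2\le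 Nc_0\mu+c_0'$ for all positive integers $k$, a given constant $\mu\ge0$ and some positive integer $N$. *)

(* Defs.v *)
From mathcomp Require Import all_boot all_order all_algebra.
From mathcomp Require Import all_classical all_reals all_analysis.

Set Implicit Arguments.
Unset Strict Implicit.
Unset Printing Implicit Defensive.

Import Order.TTheory GRing.Theory Num.Theory.
Import numFieldNormedType.Exports.

Local Open Scope ring_scope.

(* MathComp with MathComp-Analysis.
   The library's norm on matrices is the max norm, hence this separate
   Euclidean norm.  The two are equivalent, so the library's compactness,
   continuity and Lipschitz property (with unspecified constant) on
   'cV[R]_n and 'M[R]_(n, p) are the Euclidean ones. *)
Definition enorm (R : realType) (n : nat) (v : 'cV[R]_n) : R :=
  Num.sqrt (\sum_i v i ord0 ^+ 2).

(* The pseudo-inverse of a matrix of full column rank; for other matrices the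
   value is meaningless, see pseudo_inv_penrose. *)
Definition pseudo_inv (R : realType) (n p : nat) (A : 'M[R]_(n, p)) : 'M[R]_(p, n) :=
  invmx (A^T *m A) *m A^T.

Lemma gram_unitmx (R : realType) (n p : nat) (A : 'M[R]_(n, p)) :
  \rank A = p -> A^T *m A \in unitmx.
Proof.
move=> rkA; rewrite -row_free_unit -kermx_eq0; apply/rowV0P => v /sub_kermxP vK.
have w0 : v *m A^T = 0.
  have : (v *m A^T) *m (v *m A^T)^T = 0.
    by rewrite trmx_mul trmxK mulmxA -(mulmxA v) vK mul0mx.
  move=> /matrixP/(_ ord0 ord0); rewrite !mxE => /eqP.
  rewrite psumr_eq0; last by move=> i _; rewrite [X in _ * X]mxE -expr2 sqr_ge0.
  move=> /allP s0; apply/rowP => i; have := s0 i (mem_index_enum i).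
  by rewrite [X in _ * X]mxE -expr2 sqrf_eq0 => /eqP ->; rewrite mxE.
have : row_free A^T by rewrite -row_leq_rank mxrank_tr rkA.
by move=> /row_freeP[B AB]; rewrite -(mulmx1 v) -AB mulmxA w0 mul0mx.
Qed.

(* The four Penrose equations, which characterize the pseudo-inverse. *)
Lemma pseudo_inv_penrose (R : realType) (n p : nat) (A : 'M[R]_(n, p)) :
  \rank A = p ->
  [/\ A *m pseudo_inv A *m A = A,
      pseudo_inv A *m A *m pseudo_inv A = pseudo_inv A,
      (A *m pseudo_inv A)^T = A *m pseudo_inv A
    & (pseudo_inv A *m A)^T = pseudo_inv A *m A].
Proof.
move=> /gram_unitmx U; have PA : pseudo_inv A *m A = 1%:M.
  by rewrite /pseudo_inv -mulmxA mulVmx.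
split; [by rewrite -mulmxA PA mulmx1 | by rewrite PA mul1mx | | ].
  by rewrite /pseudo_inv !trmx_mul trmxK trmx_inv trmx_mul trmxK mulmxA.
by rewrite PA trmx1.
Qed.

(* Radial projection onto the closed Euclidean ball of radius r. *)
Definition proj_ball (R : realType) (n : nat) (r : R) (v : 'cV[R]_n) : 'cV[R]_n :=
  if enorm v <= r then v else (r / enorm v) *: v.

Definition fbar (R : realType) (d m : nat) (f : 'cV[R]_d -> 'cV[R]_d)
    (g : 'cV[R]_d -> 'M[R]_(d, m)) (x : 'cV[R]_d) (u : 'cV[R]_m) : 'cV[R]_d :=
  f x + g x *m u.

Definition Va (R : realType) (q m : nat) (theta : R) (Wstar K : 'M[R]_(q, m)) : R :=
  theta^-1 * \tr ((K - Wstar)^T *m (K - Wstar)).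

(* The window length N is existential and uniform in k. *)
Definition small_mean_square (R : realType) (n : nat) (mu c0 c0' : R)
    (s : nat -> 'cV[R]_n) : Prop :=
  [/\ 0 <= mu, 0 <= c0, 0 <= c0'
    & exists2 N : nat, (0 < N)%N &
        forall k : nat, (0 < k)%N ->
          \sum_(k <= t < k + N) enorm (s t) ^+ 2 <= N%:R * c0 * mu + c0'].

(* Main.v *)
(* Put s = ||phi||^2 >= 1.  Since g^+ g = 1, the innovation in the update law
   is utilde, and phi^T Ktilde = eps^T - utilde^T, so the unprojected update
   changes V_a by (1/s) (2 <utilde, eps> - (2 - theta) ||utilde||^2)
   <= (1/s) (||eps||^2 - (1 - theta) ||utilde||^2).  Projecting each column
   onto a ball that contains the column of W* only brings it closer to that
   column.  With 0 <= V_a <= 4 Wbar / theta, the decrease bounds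
   ||utilde_t||^2 already over windows of length N = 1. *)
Require Import Defs.
From mathcomp Require Import all_boot all_order all_algebra.
From mathcomp Require Import all_classical all_reals all_analysis.
From mathcomp Require Import lra ring.

Set Implicit Arguments.
Unset Strict Implicit.
Unset Printing Implicit Defensive.

Import Order.TTheory GRing.Theory Num.Theory.
Import numFieldNormedType.Exports.

Local Open Scope ring_scope.

Section EuclideanGeometry.
Variables (R : realType) (n : nat).
Implicit Types (v w : 'cV[R]_n) (a r : R).

Definition dotv v w : R := \sum_i v i ord0 * w i ord0.

Lemma enorm_sqr v : enorm v ^+ 2 = \sum_i v i ord0 ^+ 2.
Proof. by rewrite sqr_sqrtr // sumr_ge0 // => i _; exact: sqr_ge0. Qed.

Lemma enorm_ge0 v : 0 <= enorm v.
Proof. exact: sqrtr_ge0. Qed.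

Lemma enorm_sqrZ a v : enorm (a *: v) ^+ 2 = a ^+ 2 * enorm v ^+ 2.
Proof.
rewrite !enorm_sqr mulr_sumr; apply: eq_bigr => i _.
by rewrite mxE exprMn.
Qed.

Lemma enorm_sqrD v w :
  enorm (v + w) ^+ 2 = enorm v ^+ 2 + 2 * dotv v w + enorm w ^+ 2.
Proof.
rewrite !enorm_sqr /dotv mulr_sumr -!big_split; apply: eq_bigr => i _ /=.
by rewrite mxE; ring.
Qed.

Lemma enorm_sqrB v w :
  enorm (v - w) ^+ 2 = enorm v ^+ 2 - 2 * dotv v w + enorm w ^+ 2.
Proof.
rewrite !enorm_sqr /dotv mulr_sumr -sumrB -!big_split; apply: eq_bigr => i _ /=.
by rewrite !mxE; ring.
Qed.

Lemma dotvZl a v w : dotv (a *: v) w = a * dotv v w.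
Proof. by rewrite /dotv mulr_sumr; apply: eq_bigr => i _; rewrite mxE mulrA. Qed.

Lemma dotvZr a v w : dotv v (a *: w) = a * dotv v w.
Proof. by rewrite /dotv mulr_sumr; apply: eq_bigr => i _; rewrite mxE mulrCA. Qed.

(** Parallelogram law with the square of [enorm (v + w)] dropped; this is the origin of the factor 4
    in the bound on [Va]. *)
Lemma enorm_sqrB_le v w r : enorm v <= r -> enorm w <= r ->
  enorm (v - w) ^+ 2 <= 4%:R * r ^+ 2.
Proof.
move=> vr wr.
have r0 : 0 <= r := le_trans (enorm_ge0 v) vr.
have v2 : enorm v ^+ 2 <= r ^+ 2 by rewrite ler_sqr ?nnegrE ?enorm_ge0.
have w2 : enorm w ^+ 2 <= r ^+ 2 by rewrite ler_sqr ?nnegrE ?enorm_ge0.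
have := sqr_ge0 (enorm (v + w)); rewrite (enorm_sqrD v w) enorm_sqrB.
lra.
Qed.

Lemma enorm_proj_ball r v : 0 <= r -> enorm (proj_ball r v) <= r.
Proof.
move=> r0; rewrite /proj_ball; case: (leP (enorm v) r) => // rv.
have v0 : 0 < enorm v := le_lt_trans r0 rv.
rewrite -ler_sqr ?nnegrE ?enorm_ge0 // enorm_sqrZ -exprMn.
by rewrite divfK ?gt_eqF.
Qed.

(** Only [v] outside the ball matters. There the projection is [c *: v] with [c < 1], and the
    difference of the two squared distances factors through [1 - c]; the other factor is nonnegative
    once [dotv v w <= c * enorm v ^+ 2]. *)
Lemma proj_ball_closer r v w : 0 < r -> enorm w <= r ->
  enorm (proj_ball r v - w) ^+ 2 <= enorm (v - w) ^+ 2.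
Proof.
move=> r0 wr; rewrite /proj_ball; case: (leP (enorm v) r) => // rv.
have v0 : 0 < enorm v := lt_trans r0 rv.
set c := r / enorm v.
have c0 : 0 < c by rewrite divr_gt0.
have c1 : c < 1 by rewrite ltr_pdivrMr // mul1r.
have w2 : enorm w ^+ 2 <= c ^+ 2 * enorm v ^+ 2.
  by rewrite -exprMn divfK ?gt_eqF // ler_sqr ?nnegrE ?enorm_ge0 // ltW.
have dvw : dotv v w <= c * enorm v ^+ 2.
  (* Cauchy-Schwarz for this pair: expanding the square of [c *: v - w] and using [w2] bounds
     [2 * c * dotv v w] by [2 * c ^+ 2 * enorm v ^+ 2], and [c > 0] cancels. *)
  rewrite -(ler_pM2l c0).
  have := sqr_ge0 (enorm (c *: v - w)); rewrite enorm_sqrB enorm_sqrZ dotvZl.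
  lra.
rewrite !enorm_sqrB enorm_sqrZ dotvZl -subr_ge0.
have -> : enorm v ^+ 2 - 2 * dotv v w + enorm w ^+ 2 -
    (c ^+ 2 * enorm v ^+ 2 - 2 * (c * dotv v w) + enorm w ^+ 2) =
  (1 - c) * ((1 - c) * enorm v ^+ 2 + 2 * (c * enorm v ^+ 2 - dotv v w)).
  by ring.
apply: mulr_ge0; first by rewrite subr_ge0 ltW.
apply: addr_ge0; first by rewrite mulr_ge0 ?sqr_ge0 // subr_ge0 ltW.
by rewrite mulr_ge0 // subr_ge0.
Qed.

End EuclideanGeometry.

Lemma enorm_sqr_ge1 (R : realType) (n : nat) (v : 'cV[R]_n) (i : 'I_n) :
  v i ord0 = 1 -> 1 <= enorm v ^+ 2.
Proof.
move=> vi; rewrite enorm_sqr (bigD1 i) //= vi expr1n lerDl.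
by apply: sumr_ge0 => k _; exact: sqr_ge0.
Qed.

Lemma pseudo_invK (R : realType) (n p : nat) (A : 'M[R]_(n, p)) :
  \rank A = p -> pseudo_inv A *m A = 1%:M.
Proof. by move=> rkA; rewrite /pseudo_inv -mulmxA mulVmx // gram_unitmx. Qed.

(** The trace is the squared Frobenius norm. Splitting it by columns matches the projection, which
    acts on each column separately. *)
Lemma VaE (R : realType) (q m : nat) (theta : R) (W K : 'M[R]_(q, m)) :
  Va theta W K = theta^-1 * \sum_i enorm (col i K - col i W) ^+ 2.
Proof.
congr (_ * _); apply: eq_bigr => i _; rewrite mxE enorm_sqr.
by apply: eq_bigr => k _; rewrite !mxE expr2.
Qed.

Lemma Va_ge0 (R : realType) (q m : nat) (theta : R) (W K : 'M[R]_(q, m)) :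
  0 <= theta -> 0 <= Va theta W K.
Proof.
move=> t0; rewrite VaE mulr_ge0 ?invr_ge0 // sumr_ge0 // => i _.
exact: sqr_ge0.
Qed.

Lemma Va_le (R : realType) (q m : nat) (theta : R) (W K : 'M[R]_(q, m))
    (Wb : 'I_m -> R) :
  0 <= theta -> (forall i, enorm (col i W) <= Wb i) ->
  (forall i, enorm (col i K) <= Wb i) ->
  Va theta W K <= 4%:R / theta * \sum_i Wb i ^+ 2.
Proof.
move=> t0 WW KW; rewrite VaE [4%:R / theta]mulrC -mulrA.
rewrite ler_wpM2l ?invr_ge0 // mulr_sumr; apply: ler_sum => i _.
exact: enorm_sqrB_le.
Qed.

Lemma Va_proj_le (R : realType) (q m : nat) (theta : R) (W K L : 'M[R]_(q, m))
    (Wb : 'I_m -> R) :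
  0 <= theta -> (forall i, 0 < Wb i) -> (forall i, enorm (col i W) <= Wb i) ->
  (forall i, col i L = proj_ball (Wb i) (col i K)) ->
  Va theta W L <= Va theta W K.
Proof.
move=> t0 Wb0 WW LK; rewrite !VaE ler_wpM2l ?invr_ge0 //.
by apply: ler_sum => i _; rewrite LK proj_ball_closer.
Qed.

(** The columns decouple: column [i] of [p *m y^T] is [y i ord0 *: p], so each column of the error
    moves along [p] only. *)
Lemma Va_update (R : realType) (q m : nat) (theta : R) (W K : 'M[R]_(q, m))
    (p : 'cV[R]_q) (e y : 'cV[R]_m) :
  0 < theta -> 0 < enorm p ^+ 2 -> y = - ((K - W)^T *m p) + e ->
  Va theta W (K + (theta / enorm p ^+ 2) *: (p *m y^T)) - Va theta W K
    <= (enorm e ^+ 2 - (1 - theta) * enorm y ^+ 2) / enorm p ^+ 2.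
Proof.
move=> t0; set s := enorm p ^+ 2 => s0 yE.
rewrite !VaE -mulrBr -sumrB (enorm_sqr e) (enorm_sqr y) mulr_sumr [X in _ <= (_ - X) / _]mulr_sumr -sumrB mulr_suml.
apply: ler_sum => i _.
have -> : col i (K + (theta / s) *: (p *m y^T)) - col i W
    = (col i K - col i W) + (theta / s * y i ord0) *: p.
  by apply/colP => k; rewrite !mxE big_ord1 !mxE; ring.
rewrite (enorm_sqrD (col i K - col i W)) enorm_sqrZ dotvZr -/s.
(* This is entry [i] of [yE], solved for the inner product. *)
have -> : dotv (col i K - col i W) p = e i ord0 - y i ord0.
  rewrite yE !mxE opprD opprK addrCA subrr addr0.
  by apply: eq_bigr => k _; rewrite !mxE.
(* Completing the square: [2y(e - y) + theta y^2 = e^2 - (1 - theta) y^2 - (e - y)^2]. The last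
   square is then discarded. *)
have -> : theta^-1 * (enorm (col i K - col i W) ^+ 2
      + 2 * (theta / s * y i ord0 * (e i ord0 - y i ord0))
      + (theta / s * y i ord0) ^+ 2 * s - enorm (col i K - col i W) ^+ 2)
   = (e i ord0 ^+ 2 - (1 - theta) * y i ord0 ^+ 2
      - (e i ord0 - y i ord0) ^+ 2) / s.
  by field; rewrite !gt_eqF.
by rewrite ler_pM2r ?invr_gt0 // lerBlDr lerDl sqr_ge0.
Qed.

(** Strict increase makes every interval nonempty, so moving from [t] to [t.+1] crosses at most one
    switching time. It supplies the index [j] for the mean square claim, which mentions none. *)
Lemma exists_interval (tj : nat -> nat) (t : nat) :
  tj 0%N = 0%N -> (forall j, (tj j < tj j.+1)%N) ->
  exists j, (tj j <= t < tj j.+1)%N.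
Proof.
move=> tj0 tj_incr; elim: t => [|t [j /andP[jt tj1]]].
  by exists 0%N; have := tj_incr 0%N; rewrite tj0.
have [lt|ge] := ltnP t.+1 (tj j.+1).
  by exists j; rewrite lt (leq_trans jt).
by exists j.+1; rewrite ge (leq_ltn_trans tj1 (tj_incr j.+1)).
Qed.

Theorem lemma1 (R : realType) (d m nL : nat)
  (m_gt0 : (0 < m)%N) (m_le : (m <= nL.+1)%N)
  (X : set 'cV[R]_d) (X_compact : compact X)
  (f : 'cV[R]_d -> 'cV[R]_d) (f_lip : lipschitz f)
  (g : 'cV[R]_d -> 'M[R]_(d, m)) (g_lip : lipschitz g)
  (g_rank : forall z, \rank (g z) = m)
  (h : 'cV[R]_d -> 'cV[R]_m) (h_cont : continuous h)
  (x : nat -> 'cV[R]_d) (u ua um : nat -> 'cV[R]_m)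
  (u_def : forall t, u t = ua t + um t)
  (x_dyn : forall t, x t.+1 = f (x t) + g (x t) *m (u t + h (x t)))
  (x_in : forall t, X (x t))
  (Wstar : 'M[R]_(nL.+1, m)) (tj : nat -> nat)
  (tj0 : tj 0%N = 0%N) (tj_incr : forall j, (tj j < tj j.+1)%N)
  (phi : nat -> 'cV[R]_d -> 'cV[R]_(nL.+1))
  (phi1 : forall j z (i : 'I_nL.+1), (i < m)%N -> phi j z i ord0 = 1)
  (eps : nat -> 'cV[R]_d -> 'cV[R]_m)
  (h_approx : forall j z, X z -> h z = Wstar^T *m phi j z + eps j z)
  (theta : R) (theta_gt0 : 0 < theta) (theta_lt1 : theta < 1)
  (K Kbar : nat -> 'M[R]_(nL.+1, m))
  (ua_def : forall t j, (tj j <= t < tj j.+1)%N ->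
     ua t = - ((K t)^T *m phi j (x t)))
  (Kbar_def : forall t j, (tj j <= t < tj j.+1)%N ->
     Kbar t.+1 = K t + (theta / enorm (phi j (x t)) ^+ 2) *:
       (phi j (x t) *m
          (pseudo_inv (g (x t)) *m (x t.+1 - fbar f g (x t) (um t)))^T))
  (Wb : 'I_m -> R)
  (K_proj : forall t i, col i (K t.+1) = proj_ball (Wb i) (col i (Kbar t.+1)))
  (K0 : forall i, enorm (col i (K 0%N)) <= Wb i)
  (sigma epsb : R)
  (Wb_gt0 : forall i, 0 < Wb i) (sigma_gt0 : 0 < sigma) (epsb_gt0 : 0 < epsb)
  (Wstar_le : forall i, enorm (col i Wstar) <= Wb i)
  (phi_le : forall j z, X z -> enorm (phi j z) <= sigma)
  (eps_le : forall j z, X z -> enorm (eps j z) <= epsb) :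
  let Wbar : R := \sum_i Wb i ^+ 2 in
  let utilde : nat -> 'cV[R]_m := fun t => ua t + h (x t) in
  let c0 : R := sigma ^+ 2 / (1 - theta) in
  [/\ forall t, Va theta Wstar (K t) <= 4%:R / theta * Wbar,
      forall t j, (tj j <= t < tj j.+1)%N ->
        Va theta Wstar (K t.+1) - Va theta Wstar (K t)
          <= - ((1 - theta) / sigma ^+ 2) * enorm (utilde t) ^+ 2
             + enorm (eps j (x t)) ^+ 2
    & small_mean_square (epsb ^+ 2) c0 (4%:R * c0 / theta * Wbar) utilde].
Proof.
move=> Wbar utilde c0.
have theta_ge0 := ltW theta_gt0.
have om_gt0 : 0 < 1 - theta by rewrite subr_gt0.
have KW t i : enorm (col i (K t)) <= Wb i.
  by case: t => [//|t]; rewrite K_proj enorm_proj_ball ?ltW.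
have Vle t : Va theta Wstar (K t) <= 4%:R / theta * Wbar by exact: Va_le.
have c0_gt0 : 0 < c0 by rewrite divr_gt0 ?exprn_gt0.
have dec t j : (tj j <= t < tj j.+1)%N ->
    Va theta Wstar (K t.+1) - Va theta Wstar (K t)
    <= - ((1 - theta) / sigma ^+ 2) * enorm (utilde t) ^+ 2
       + enorm (eps j (x t)) ^+ 2.
  move=> tjP; set p := phi j (x t); set s := enorm p ^+ 2.
  have s_ge1 : 1 <= s.
    (* The witness is entry 0, which is one of the first [m] entries because [0 < m]. *)
    exact: (@enorm_sqr_ge1 _ _ _ (Ordinal (leq_trans m_gt0 m_le))) (phi1 _ _ _ _).
  have s_gt0 : 0 < s := lt_le_trans ltr01 s_ge1.
  have s_le : s <= sigma ^+ 2.
    by rewrite ler_sqr ?nnegrE ?enorm_ge0 ?phi_le // ltW.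
  (* Subtracting the prediction made with [um] alone leaves [g] times [ua + h]; full column rank
     makes the pseudo-inverse a left inverse of [g]. *)
  have innov : pseudo_inv (g (x t)) *m (x t.+1 - fbar f g (x t) (um t))
      = utilde t.
    have -> : x t.+1 - fbar f g (x t) (um t) = g (x t) *m utilde t.
      rewrite x_dyn u_def /fbar /utilde !mulmxDr; apply/colP => k; rewrite !mxE.
      by ring.
    by rewrite mulmxA pseudo_invK // mul1mx.
  have utildeE : utilde t = - ((K t - Wstar)^T *m p) + eps j (x t).
    rewrite /utilde (ua_def _ _ tjP) (h_approx j _ (x_in t)) -/p.
    by rewrite linearB mulmxBl opprB addrA [_ - _]addrC.
  have := Va_proj_le theta_ge0 Wb_gt0 Wstar_le (K_proj t).
  rewrite (Kbar_def _ _ tjP) innov -/p -/s => proj_le.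
  have := Va_update theta_gt0 s_gt0 utildeE; rewrite -/s => upd_le.
  (* The factor [1 / s] is removed differently in the two terms: [s >= 1] for the error,
     [s <= sigma ^+ 2] for the decrease. *)
  have e_le : enorm (eps j (x t)) ^+ 2 / s <= enorm (eps j (x t)) ^+ 2.
    by rewrite ler_pdivrMr // ler_peMr ?sqr_ge0.
  have u_le : (1 - theta) / sigma ^+ 2 * enorm (utilde t) ^+ 2
      <= (1 - theta) * enorm (utilde t) ^+ 2 / s.
    rewrite mulrAC ler_wpM2l //.
      by apply: mulr_ge0; [exact: ltW | exact: sqr_ge0].
    by rewrite lef_pV2 // posrE exprn_gt0.
  move: upd_le; rewrite mulrBl; lra.
split=> //; split.
- exact: sqr_ge0.
- exact: ltW.
- have Wbar_ge0 : 0 <= Wbar by apply: sumr_ge0 => i _; exact: sqr_ge0.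
  apply: mulr_ge0 => //; apply: divr_ge0 => //.
  by apply: mulr_ge0 => //; exact: ltW.
exists 1%N => // k _; rewrite addn1 big_nat1 mul1r.
have [j kj] := exists_interval k tj0 tj_incr.
have := dec k j kj; have := Vle k; have := Va_ge0 Wstar (K k.+1) theta_ge0.
have e_le : enorm (eps j (x k)) ^+ 2 <= epsb ^+ 2.
  by rewrite ler_sqr ?nnegrE ?enorm_ge0 ?eps_le // ltW.
have -> : (1 - theta) / sigma ^+ 2 = c0^-1 by rewrite invf_div.
move=> V1 V0 dV.
(* One step of the decrease, with [Va] at [k.+1] bounded below by 0 and at [k] above by its uniform
   bound; multiplying by [c0] turns that bound into the additive constant. *)
have u_le : c0^-1 * enorm (utilde k) ^+ 2 <= epsb ^+ 2 + 4%:R / theta * Wbar.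
  by lra.
have -> : c0 * epsb ^+ 2 + 4%:R * c0 / theta * Wbar
  = c0 * (epsb ^+ 2 + 4%:R / theta * Wbar) by ring.
by rewrite -ler_pdivrMl.
Qed.
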